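(* Let $n_1,n_2,n_3\ge1$ be integers, $N=n_1+n_2+n_3$, and let $k$ be an integer with $1\le k\le N/2$. For integers $m$ with $$\max\{0,k-n_3\}\le m\le\min\{n_1,n_2,k,n_1+n_2-k\}$$ define $$\psi_m(x):=\sum_{u,v\ge0,\;u+v\le k}\widetilde\psi_m(u,v)\,e_u\bigl(x_\ast^{(1)}\bigr)\,e_v\bigl(x_\ast^{(2)}\bigr)\,e_{k-u-v}\bigl(x_\ast^{(3)}\bigr).$$ Then the polynomials $\psi_m$, with $m$ ranging over the integers satisfying $\max\{0,k-n_3\}\le m\le\min\{n_1,n_2,k,n_1+n_2-k\}$, form a basis of the space of $G_{\mathbf n}$-invariant elements of $V_k$.
   Context: $\mathcal S_N$ acts on polynomials in $x=(x_1,\dots,x_N)$ by $wP(x)=P(xw)$, $(xw)_i=x_{w(i)}$. $V_k$ is the space of polynomials $p=\sum_{E\subset\{1,\dots,N\},\,\#E=k}c_E\prod_{i\in E}x_i$ satisfying $\sum_{i=1}^N\frac{\partial}{\partial x_i}p=0$; it is an irreducible $\mathcal S_N$-module of isotype $[N-k,k]$. $G_{\mathbf n}\cong\mathcal S_{n_1}\times\mathcal S_{n_2}\times\mathcal S_{n_3}$ is the subgroup of $\mathcal S_N$ leaving each of the intervals $I_1=\{1,\dots,n_1\}$, $I_2=\{n_1+1,\dots,n_1+n_2\}$, $I_3=\{n_1+n_2+1,\dots,N\}$ setwise invariant. $e_i(x_\ast^{(j)})$ is the elementary symmetric polynomial of degree $i$ in the variables $x_s$, $s\in I_j$ (zero if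 $i>n_j$). With the Pochhammer symbol $(\alpha)_j=\prod_{i=1}^j(\alpha+i-1)$, define $$\widetilde\psi_m^{(1)}(t):=\sum_{j=0}^{k-m}\frac{(m-k)_j}{j!}(n_1+n_2-k-m+1)_j\,(n_3-k+m+1)_{k-m-j}\,(t-k)_j\,(m-t)_{k-m-j},$$ $$\widetilde\psi_m^{(2)}(u,v):=\sum_{i=0}^{m}\frac{(-m)_i}{i!}(n_1-m+1)_i\,(n_2-m+1)_{m-i}\,(-v)_i\,(-u)_{m-i},$$ $$\widetilde\psi_m(u,v):=\widetilde\psi_m^{(1)}(u+v)\,\widetilde\psi_m^{(2)}(u,v).$$ (These are Hahn polynomials in two variables.) *)

(* Defs.v *)
From HB Require Import structures.
From mathcomp Require Import all_boot all_order all_algebra all_fingroup.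
From mathcomp Require Import mpoly.

Set Implicit Arguments.
Unset Strict Implicit.
Unset Printing Implicit Defensive.

Import Order.TTheory GRing.Theory Num.Theory.
Local Open Scope ring_scope.

(* {mpoly F[n]} is infinite-dimensional, hence not a vectType, so that
   vector.basis_of does not apply to its subspaces. *)
Definition is_basis (F : fieldType) (V : lmodType F) (I : finType)
    (W : V -> Prop) (b : I -> V) : Prop :=
  (forall c : I -> F, \sum_i c i *: b i = 0 -> forall i, c i = 0)
  /\ (forall p : V, W p <-> exists c : I -> F, p = \sum_i c i *: b i).

Definition poch (F : fieldType) (a : F) (j : nat) : F :=
  \prod_(i < j) (a + i%:R).

Section Intervals.
Variables n1 n2 n3 : nat.
Local Notation N := (n1 + n2 + n3)%N.

(* The variables are numbered from 0. *)
Definition intv1 : {set 'I_N} := [set i : 'I_N | (i < n1)%N].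
Definition intv2 : {set 'I_N} := [set i : 'I_N | (n1 <= i < n1 + n2)%N].
Definition intv3 : {set 'I_N} := [set i : 'I_N | (n1 + n2 <= i)%N].

Definition Gn : {group 'S_N} :=
  ('N(intv1 | 'P) :&: 'N(intv2 | 'P) :&: 'N(intv3 | 'P))%G.

End Intervals.

Section Polynomials.
Variables (F : fieldType) (N : nat).

Definition in_Vk (k : nat) (p : {mpoly F[N]}) : Prop :=
  (exists c : {set 'I_N} -> F,
     p = \sum_(E : {set 'I_N} | #|E| == k) c E *: \prod_(i in E) 'X_i)
  /\ \sum_(i < N) p^`M(i) = 0.

(* msym w p substitutes 'X_(w i) for 'X_i, i.e. it is x |-> p(xw). *)
Definition perm_invariant (G : {set 'S_N}) (p : {mpoly F[N]}) : Prop :=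
  forall w : 'S_N, w \in G -> msym w p = p.

Definition esym_on (A : {set 'I_N}) (d : nat) : {mpoly F[N]} :=
  \sum_(E : {set 'I_N} | (E \subset A) && (#|E| == d)) \prod_(s in E) 'X_s.

End Polynomials.

Section Hahn.
Variables (F : fieldType) (n1 n2 n3 k : nat).
Local Notation N := (n1 + n2 + n3)%N.

(* The subtractions between parentheses below are in F; only the bounds and
   lengths k - m, k - m - j, m - i are truncated, and they are never negative
   when m <= k. *)
Definition psit1 (m : nat) (t : F) : F :=
  \sum_(j < (k - m).+1)
    poch (m%:R - k%:R) j / (j`!)%:R
    * poch (n1%:R + n2%:R - k%:R - m%:R + 1) j
    * poch (n3%:R - k%:R + m%:R + 1) (k - m - j)
    * poch (t - k%:R) j
    * poch (m%:R - t) (k - m - j).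

Definition psit2 (m : nat) (u v : F) : F :=
  \sum_(i < m.+1)
    poch (- m%:R) i / (i`!)%:R
    * poch (n1%:R - m%:R + 1) i
    * poch (n2%:R - m%:R + 1) (m - i)
    * poch (- v) i
    * poch (- u) (m - i).

Definition psit (m : nat) (u v : F) : F := psit1 m (u + v) * psit2 m u v.

Definition psi (m : nat) : {mpoly F[N]} :=
  \sum_(u < k.+1) \sum_(v < k.+1 | (u + v <= k)%N)
    psit m u%:R v%:R
    *: (esym_on F (intv1 n1 n2 n3) u
        * esym_on F (intv2 n1 n2 n3) v
        * esym_on F (intv3 n1 n2 n3) (k - u - v)).

End Hahn.

(* The bounds are computed in int: n1 + n2 - k may be negative, in which case
   no m is admissible. *)
Definition admissible (n1 n2 n3 k m : nat) : bool :=
  (Num.max 0 (k%:Z - n3%:Z) <= m%:Z)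
  && (m%:Z <= Num.min (Num.min n1%:Z n2%:Z)
                      (Num.min k%:Z (n1%:Z + n2%:Z - k%:Z))).

(* Admissible integers are nonnegative and at most k, so ranging over 'I_k.+1
   loses none of them. *)
Definition psi_index (n1 n2 n3 k : nat) : finType :=
  {m : 'I_k.+1 | admissible n1 n2 n3 k m}.

(* Main.v *)
Require Import Defs.
From HB Require Import structures.
From mathcomp Require Import all_boot all_order all_algebra all_fingroup.
From mathcomp Require Import mpoly.
From mathcomp Require Import ring zify.

Set Implicit Arguments.
Unset Strict Implicit.
Unset Printing Implicit Defensive.

Import Order.TTheory GRing.Theory Num.Theory.
Local Open Scope ring_scope.

(** A squarefree homogeneous polynomial of degree k that is invariant under
    the block group is determined by a table f : the monomial of a set E has
    coefficient f u v, where u and v are the numbers of elements of E in the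
    first two blocks ([invariant_blockpoly]; the block group is transitive on
    the sets of a given type, [Gn_transitive]). The operator
    sum_i d/dx_i takes the monomial of E to the sum of the monomials of the
    E minus one point, so it annihilates the polynomial exactly when, for all
    u + v + w = k - 1 with u <= n1, v <= n2, w <= n3,
      (n1 - u) f(u+1,v) + (n2 - v) f(u,v+1) + (n3 - w) f(u,v) = 0.
    This is [balanced], and everything else is about its solutions.

    The Hahn tables are solutions. The factor psit2 satisfies a first order
    identity in u and v ([psit2_lower]), in which the operator on the left
    multiplies it by n1 + n2 - m - (u + v). Among the integers
    t with m <= t <= k a single term of the sum psit1 survives, and the closed
    form obtained for psit1 satisfies the recurrence in t = u + v that remains
    ([psit1_step]). Below the diagonal u + v = m the factor psit2 vanishes.

    The tables are triangular for the functionals f |-> f(m,0): the table of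
    index m vanishes on the diagonals below m and is nonzero at (m,0). Hence
    they are linearly independent, and they span as soon as a solution
    with f(m,0) = 0 for every admissible m is zero ([balanced_eq0],
    [triangular_is_basis]).

    For this last point put f = (n1 - u)! (n2 - v)! (n3 - w)! h, where now
    u + v + w = k, and extend h by zero outside the box. The equation loses
    its coefficients: h(u+1,v) + h(u,v+1) + h(u,v) = 0. Let t be the
    lowest diagonal where h is not known to vanish. Up to the sign (-1)^v, h
    is constant on it. If t exceeds n1 or n2, one end of the
    diagonal lies outside the box and the constant is 0; if k - t exceeds n3,
    the whole diagonal lies outside; if t is admissible,
    the constant is 0 by assumption. In the remaining case t + k > n1 + n2.
    There (-1)^v h is, on the top diagonal u + v = k, a polynomial of degree
    at most k - t in u, whose coefficient of degree k - t is the constant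
    up to a nonzero factor, since taking finite differences leads from each
    diagonal to the one below ([newton_diagonal]). It vanishes at the points
    of the top diagonal outside the box, of which there are more than k - t,
    so the constant is 0 ([plane_eq0]). *)

(** * Pochhammer symbols in characteristic zero *)

Lemma poch0 (F : fieldType) (a : F) : poch a 0 = 1.
Proof. by rewrite /poch big_ord0. Qed.

Lemma pochS (F : fieldType) (a : F) j : poch a j.+1 = poch a j * (a + j%:R).
Proof. by rewrite /poch big_ord_recr. Qed.

Lemma pochSl (F : fieldType) (a : F) j : poch a j.+1 = a * poch (a + 1) j.
Proof.
rewrite /poch big_ord_recl addr0; congr (_ * _); apply: eq_bigr => i _.
by rewrite -addrA -natr1 [1 + _]addrC.
Qed.

Lemma poch_pred (F : fieldType) (a : F) j :
  poch (a - 1) j = poch a j - j%:R * poch a j.-1.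
Proof.
case: j => [|j]; first by rewrite !poch0 mul0r subr0.
by rewrite pochSl subrK pochS /= -natr1; ring.
Qed.

Lemma poch_oppn_eq0 (F : fieldType) u j : (u < j)%N -> poch (- u%:R : F) j = 0.
Proof. by move=> lt_uj; rewrite /poch (bigD1 (Ordinal lt_uj)) //= addNr mul0r. Qed.

Section CharacteristicZero.
Variables (F : fieldType) (charF0 : [pchar F] =i pred0).

Lemma natr_char0_neq0 n : (0 < n)%N -> (n%:R : F) != 0.
Proof. by move: charF0 => /GRing.pcharf0P -> ; rewrite -lt0n. Qed.

Lemma natr_char0_inj : injective (fun n => n%:R : F).
Proof.
suff leP m n : (m <= n)%N -> m%:R = n%:R :> F -> m = n.
  by move=> m n; case: (leqP m n) => [/leP|/ltnW/leP le_nm /esym/le_nm].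
move=> le_mn /esym/eqP; rewrite -subr_eq0 -natrB //; apply: contraTeq => ne_mn.
by apply: natr_char0_neq0; rewrite subn_gt0 ltn_neqAle ne_mn.
Qed.

Lemma poch_posn_neq0 n j : poch (n.+1%:R : F) j != 0.
Proof. by apply/prodf_neq0 => i _; rewrite -natrD natr_char0_neq0. Qed.

Lemma poch_oppn_neq0 n j : (j <= n)%N -> poch (- n%:R : F) j != 0.
Proof.
move=> le_jn; apply/prodf_neq0 => i _.
have lt_in : (i < n)%N by apply: leq_trans le_jn.
by rewrite -oppr_eq0 opprD opprK -natrB 1?ltnW // natr_char0_neq0 ?subn_gt0.
Qed.

(** * The Hahn polynomials solve the lowering equation *)

Variables (n1 n2 n3 k : nat).

(** Shifting u or v by one changes a single rising factorial by a backward
    difference. Writing the result in the products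
    poch (-v) i * poch (-u) (m - 1 - i), the coefficients telescope because of
    the two-term recurrence satisfied by the hypergeometric coefficients
    [a i]. *)
Lemma psit2_lower m (u v : F) :
  (n1%:R - u) * psit2 n1 n2 m (u + 1) v + (n2%:R - v) * psit2 n1 n2 m u (v + 1)
  = (n1%:R + n2%:R - m%:R - (u + v)) * psit2 n1 n2 m u v.
Proof.
rewrite /psit2 !opprD; set X := poch (- u); set Y := poch (- v).
pose a i := poch (- m%:R : F) i / i`!%:R * poch (n1%:R - m%:R + 1) i
            * poch (n2%:R - m%:R + 1) (m - i).
pose T i := i%:R * a i * (n2%:R - i%:R + 1) * Y i.-1 * X (m - i)%N.
apply/eqP; rewrite -subr_eq0 !mulr_sumr -big_split -sumrB /=; apply/eqP.
have aS i : (i < m)%N ->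
    i.+1%:R * a i.+1 * (n2%:R - i%:R)
    = (i%:R - m%:R) * (n1%:R - m%:R + 1 + i%:R) * a i.
  move=> lt_im; rewrite /a pochS factS natrM pochS.
  have -> : (m - i = (m - i.+1).+1)%N by lia.
  rewrite pochS natrB // -natr1; field.
  by rewrite natr1 !natr_char0_neq0 // fact_gt0.
(* For i < m the first term of the summand equals T i.+1, so the sum telescopes;
   the first term at i = m and T 0 are zero. *)
rewrite (eq_bigr (fun i : 'I_m.+1 =>
    (m%:R - i%:R) * (n1%:R - m%:R + i%:R + 1) * a i * Y i * X (m - i).-1 * -1
    - T i)); last first.
  move=> [i /= le_im] _; rewrite !poch_pred -/X -/Y -/(a i).
  have XE : (m - i)%:R * X (m - i)%N
      = (m - i)%:R * (- u + (m - i).-1%:R) * X (m - i).-1.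
    case: (m - i)%N => [|r]; first by rewrite !mul0r.
    by rewrite /X pochS; ring.
  have YE : i%:R * Y i = i%:R * (- v + i.-1%:R) * Y i.-1.
    case: (i) => [|r]; first by rewrite !mul0r.
    by rewrite /Y pochS; ring.
  have Em : (m - i)%:R * (m - i).-1%:R = (m - i)%:R * ((m - i)%:R - 1) :> F.
    by case: (m - i)%N => [|r]; rewrite ?mul0r //= -natr1 addrK.
  have Ei : i%:R * i.-1%:R = i%:R * (i%:R - 1) :> F.
    by case: (i) => [|r]; rewrite ?mul0r //= -natr1 addrK.
  rewrite mulrDr Em -mulrDr in XE; rewrite mulrDr Ei -mulrDr in YE.
  rewrite /T.
  have le_im' : (i <= m)%N by [].
  move/eqP: XE; rewrite -subr_eq0 => /eqP XE.
  move/eqP: YE; rewrite -subr_eq0 => /eqP YE.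
  apply/eqP; rewrite -subr_eq0 -[X in _ == X](mulr0 (a i * Y i)) -XE.
  rewrite -[X in _ == X]addr0 -[X in _ == _ + X](mulr0 (a i * X (m - i)%N)) -YE.
  by apply/eqP; rewrite natrB //; ring.
have T0 : T 0%N = 0 by rewrite /T !mul0r.
rewrite sumrB big_ord_recr /= subrr !mul0r addr0 big_ord_recl /= T0.
rewrite add0r -sumrB big1 // => i _; rewrite /T /bump /= add1n.
have -> : ((m - i).-1 = m - i.+1)%N by lia.
have -> : n2%:R - i.+1%:R + 1 = n2%:R - i%:R :> F by rewrite -natr1; ring.
move/eqP: (aS i (ltn_ord i)); rewrite -subr_eq0 => /eqP aSi.
by rewrite -[RHS](mulr0 (- (Y i * X (m - i.+1)%N))) -aSi -natr1 add0n; ring.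
Qed.

(** One of the two vanishing ranges i > v and m - i > u contains each i. *)
Lemma psit2_eq0 m u v : (u + v < m)%N -> psit2 n1 n2 m u%:R v%:R = 0 :> F.
Proof.
move=> lt_uvm; rewrite /psit2 big1 // => i _.
have [lt_vi|le_iv] := ltnP v i.
  by rewrite (poch_oppn_eq0 _ lt_vi) mulr0 mul0r.
by rewrite [X in _ * X]poch_oppn_eq0 ?mulr0 //; lia.
Qed.

Lemma psit2_neq0 m : (m <= n1)%N -> (m <= n2)%N ->
  psit2 n1 n2 m m%:R 0%:R != 0 :> F.
Proof.
move=> le_m1 le_m2; rewrite /psit2 (bigD1 ord0) //= big1 => [|i ne_i0].
  rewrite !poch0 subn0 addr0 fact0 divr1 !mulr1 mul1r -natrB // natr1.
  by rewrite mulf_neq0 ?poch_posn_neq0 ?poch_oppn_neq0.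
by rewrite (@poch_oppn_eq0 F 0) ?mulr0 ?mul0r // lt0n; apply: contra ne_i0.
Qed.

(** The factor poch (t - k) j kills the terms with j > k - t, and
    poch (m - t) (k - m - j) those with j < k - t. *)
Lemma psit1_nat m t : (m <= t <= k)%N ->
  psit1 n1 n2 n3 k m (t%:R : F) =
    poch (m%:R - k%:R) (k - t) / (k - t)`!%:R
    * poch (n1%:R + n2%:R - k%:R - m%:R + 1) (k - t)
    * poch (n3%:R - k%:R + m%:R + 1) (t - m)
    * poch (t%:R - k%:R) (k - t)
    * poch (m%:R - t%:R) (t - m).
Proof.
case/andP=> le_mt le_tk.
have lt_j : (k - t < (k - m).+1)%N by lia.
rewrite /psit1 (bigD1 (Ordinal lt_j)) //= big1 ?addr0 => [|i ne_i].
  by have -> : (k - m - (k - t) = t - m)%N by lia.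
have [lt_ti|le_it] := ltnP (k - t) i.
  by rewrite -[t%:R - _]opprB -(natrB F le_tk) (poch_oppn_eq0 _ lt_ti) mulr0 mul0r.
rewrite -[m%:R - t%:R]opprB -(natrB F le_mt) [X in _ * X]poch_oppn_eq0 ?mulr0 //.
suff : i != (k - t)%N :> nat by lia.
by apply: contra ne_i => /eqP Ei; apply/eqP/val_inj.
Qed.

(** Passing from t to t + 1, each Pochhammer symbol of the closed form gains or
    loses one factor. Those of the second and third symbols are the two
    coefficients of the recurrence; the others cancel up to the sign. *)
Lemma psit1_step m t : (m <= t < k)%N ->
  (n1%:R + n2%:R - m%:R - t%:R) * psit1 n1 n2 n3 k m (t.+1%:R : F)
  + (n3%:R - (k - t.+1)%:R) * psit1 n1 n2 n3 k m t%:R = 0.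
Proof.
case/andP=> le_mt lt_tk; rewrite !psit1_nat; try lia.
have [d dE] : exists d, (k = t.+1 + d)%N by exists (k - t.+1)%N; lia.
have [s sE] : exists s, (t = m + s)%N by exists (t - m)%N; lia.
have -> : (k - t = d.+1)%N by lia.
have -> : (k - t.+1 = d)%N by lia.
have -> : (t.+1 - m = s.+1)%N by lia.
have -> : (t - m = s)%N by lia.
rewrite (pochSl (t%:R - k%:R)) (pochSl (m%:R - t.+1%:R)).
rewrite (pochS (m%:R - k%:R)) (pochS (_ + 1) d) (pochS (_ + 1) s) factS natrM.
have -> : t%:R - k%:R + 1 = t.+1%:R - k%:R :> F by rewrite -natr1; ring.
have -> : m%:R - t.+1%:R + 1 = m%:R - t%:R :> F by rewrite -natr1; ring.
rewrite dE sE !natrD -!natr1 !natrD; field.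
by rewrite natr1 !natr_char0_neq0 // fact_gt0.
Qed.

Lemma psit1_neq0 m : (m <= k)%N -> (m + k <= n1 + n2)%N ->
  psit1 n1 n2 n3 k m (m%:R : F) != 0.
Proof.
move=> le_mk le_mk12; rewrite psit1_nat ?leqnn // subnn !poch0 !mulr1.
rewrite -[m%:R - _]opprB -natrB // -[_ + _ - _ - _]addrA -opprD -!natrD.
rewrite -natrB; last by rewrite addnC.
by rewrite natr1 !mulf_neq0 ?invr_eq0 ?poch_posn_neq0 ?poch_oppn_neq0
           ?natr_char0_neq0 ?fact_gt0.
Qed.

(** The coefficientwise form of the equation sum_i dp/dx_i = 0 for the
    polynomial p with table f. The truncated subtractions are exact, since the
    equation is imposed only at (u, v, w) in the box, w = k - 1 - u - v;
    elsewhere it does not correspond to any monomial. *)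
Definition balanced (f : nat -> nat -> F) := forall u v : nat,
  (u + v < k)%N -> (u <= n1)%N -> (v <= n2)%N -> (k - (u + v).+1 <= n3)%N ->
  (n1 - u)%:R * f u.+1 v + (n2 - v)%:R * f u v.+1
  + (n3 - (k - (u + v).+1))%:R * f u v = 0.

Lemma balanced_lin a (f g : nat -> nat -> F) :
  balanced f -> balanced g -> balanced (fun u v => a * f u v + g u v).
Proof.
move=> balf balg u v lt_uvk le1 le2 le3.
have /= := congr2 (fun x y => a * x + y) (balf u v lt_uvk le1 le2 le3)
                                        (balg u v lt_uvk le1 le2 le3).
by rewrite mulr0 addr0 => <-; ring.
Qed.

(** From the diagonal u + v = m on, [psit2_lower] reduces the equation to
    [psit1_step]. Below it psit2 vanishes at (u, v), hence so does the right-hand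
    side of [psit2_lower], even when (u+1, v) is on the diagonal. *)
Lemma psit_balanced m : balanced (fun u v => psit n1 n2 n3 k m u%:R v%:R).
Proof.
move=> u v lt_uvk le_u1 le_v2 le_w3; rewrite /psit -!natrD addSn addnS.
have [lt_uvm|le_muv] := ltnP (u + v) m; last first.
  rewrite !natrB // mulrCA (mulrCA (_ - v%:R)) -mulrDr -!natr1 psit2_lower.
  rewrite -natrD natr1.
  have := @psit1_step m (u + v); rewrite le_muv lt_uvk natrB // => /(_ isT) E.
  by rewrite mulrA -[RHS](mul0r (psit2 n1 n2 m u%:R v%:R)) -E; ring.
rewrite (psit2_eq0 lt_uvm) !mulr0 addr0.
rewrite !natrB // mulrCA (mulrCA (_ - v%:R)) -mulrDr -!natr1 psit2_lower.
by rewrite (psit2_eq0 lt_uvm) !mulr0.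
Qed.

End CharacteristicZero.

(** * Uniqueness of solutions of the lowering equation *)

Lemma admissibleE n1 n2 n3 k m : admissible n1 n2 n3 k m =
  [&& k <= m + n3, m <= n1, m <= n2, m <= k & m + k <= n1 + n2]%N.
Proof.
rewrite /admissible ge_max !le_min; lia.
Qed.

Section Uniqueness.
Variables (F : fieldType) (charF0 : [pchar F] =i pred0).

(** The sum is the value at u of a polynomial in u of degree at most d, and a d / d!
    is its coefficient of degree d. *)
Lemma binomial_sum_roots d (a : nat -> F) (s : seq nat) :
    uniq s -> (d < size s)%N ->
    {in s, forall u, \sum_(j < d.+1) a j * 'C(u, j)%:R = 0} ->
  a d = 0.
Proof.
move=> s_uniq lt_ds s_root.
pose B j : {poly F} := \prod_(x <- [seq i%:R | i <- iota 0 j]) ('X - x%:P).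
have sizeB j : size (B j) = j.+1 by rewrite size_prod_XsubC size_map size_iota.
have fact_neq0 j : j`!%:R != 0 :> F by rewrite natr_char0_neq0 ?fact_gt0.
have evalB u j : (B j).[u%:R] = 'C(u, j)%:R * j`!%:R.
  rewrite -natrM bin_ffact; elim: j => [|j IHj];
    first by rewrite /B big_nil hornerC.
  rewrite /B -addn1 iotaD map_cat big_cat /= big_seq1 hornerM -/(B j) IHj add0n.
  rewrite addn1 ffactnSr natrM hornerXsubC.
  by have [le_ju|lt_uj] := leqP j u; [rewrite natrB | rewrite ffact_small ?mul0r].
pose P := \sum_(j < d.+1) (a j / j`!%:R) *: B j.
have P0 : P = 0.
  apply: contraTeq lt_ds => /max_poly_roots ltP.
  have /ltP : all (root P) [seq u%:R | u <- s].
    apply/allP => _ /mapP[u su ->]; apply/rootP; rewrite -(s_root u su) horner_sum.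
    apply: eq_bigr => j _; by rewrite hornerZ evalB [_%:R * _]mulrC mulrA divfK.
  rewrite map_inj_uniq //; last exact: natr_char0_inj.
  rewrite size_map -leqNgt => /(_ s_uniq) /leq_trans leP; rewrite -ltnS; apply: leP.
  apply: (leq_trans (size_sum _ _ _)); apply/bigmax_leqP => j _.
  by rewrite (leq_trans (size_scale_leq _ _)) // sizeB.
have /eqP : P`_d = 0 by rewrite P0 coef0.
rewrite coef_sum big_ord_recr /= big1 => [|j _]; last first.
  by rewrite coefZ nth_default ?mulr0 // sizeB.
have Bd : (B d)`_d = 1.
  by have /monicP := monic_prod_XsubC [seq i%:R : F | i <- iota 0 d] predT id;
     rewrite /lead_coef -/(B d) sizeB.
rewrite add0r coefZ Bd mulr1 mulf_eq0 invr_eq0 (negPf (fact_neq0 d)) orbF.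
by move/eqP.
Qed.

Section Plane.
Variables (k : nat) (h : nat -> nat -> F).
Hypothesis h_rel : forall u v, (u + v < k)%N -> h u.+1 v + h u v.+1 + h u v = 0.

(** Along a diagonal the relation says that the difference of (-1)^v h in the
    variable u is, up to sign, the same function one diagonal below. In the
    Newton basis of binomial coefficients, summation is a shift of the
    coefficients, so the constant c on diagonal t becomes the top coefficient
    d diagonals above. *)
Lemma newton_diagonal t c d : (t + d <= k)%N ->
    (forall u v, (u + v)%N = t -> (-1) ^+ v * h u v = c) ->
  exists2 a : nat -> F, a d = (-1) ^+ d * c &
    forall u v, (u + v = t + d)%N ->
      (-1) ^+ v * h u v = \sum_(j < d.+1) a j * 'C(u, j)%:R.
Proof.
move=> le_tdk h_t; elim: d le_tdk => [|d IHd] le_tdk.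
  exists (fun=> c) => [|u v]; first by rewrite mul1r.
  by rewrite addn0 => /h_t ->; rewrite big_ord1 bin0 mulr1.
have {IHd}[|a a_d h_d] := IHd; first by lia.
exists (fun j => if j is i.+1 then - a i
                 else (-1) ^+ (t + d.+1) * h 0%N (t + d.+1)%N).
  by rewrite a_d exprS mulN1r mulNr.
elim=> [v|u IHu v]; first rewrite add0n => ->.
  rewrite big_ord_recl big1 ?addr0 ?mulr1 // => j _.
  by rewrite lift0 bin0n mulr0.
move=> uvE; have uvE' : (u + v = t + d)%N by lia.
have -> : (-1) ^+ v * h u.+1 v = (-1) ^+ v.+1 * h u v.+1 - (-1) ^+ v * h u v.
  have := h_rel (u := u) (v := v); rewrite uvE' => /(_ ltac:(lia)) E.
  by rewrite -[LHS]subr0 -(mulr0 ((-1) ^+ v)) -E exprS; ring.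
rewrite IHu ?(h_d u v) //; last by lia.
rewrite big_ord_recl [RHS]big_ord_recl /= !bin0 -addrA; congr (_ + _).
rewrite -sumrB; apply: eq_bigr => j _; rewrite binS natrD; ring.
Qed.

Variables n1 n2 n3 : nat.
Hypothesis h_out : forall u v, (u + v <= k)%N ->
  [|| n1 < u, n2 < v | n3 < k - (u + v)]%N -> h u v = 0.
Hypothesis h_adm : forall m, admissible n1 n2 n3 k m -> h m 0 = 0.

(** Induction on the diagonal t = u + v. The vanishing on the lower diagonals
    makes (-1)^v h constant on diagonal t. *)
Lemma plane_eq0 u v : (u + v <= k)%N -> h u v = 0.
Proof.
move: {2}(u + v)%N (erefl (u + v)%N) => t.
elim/ltn_ind: t u v => t IHt u v uvE; rewrite uvE => le_tk.
have [lt_3|le_3] := ltnP n3 (k - t); first by rewrite h_out ?uvE ?lt_3 ?orbT.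
have h_t i j : (i + j)%N = t -> (-1) ^+ j * h i j = h t 0%N.
  elim: j i => [|j IHj] i; first by rewrite addn0 mul1r => ->.
  move=> ijE; rewrite -(IHj i.+1) ?addSnnS //.
  have lt_ijt : (i + j < t)%N by lia.
  have := h_rel (u := i) (v := j) (leq_trans lt_ijt le_tk).
  rewrite (IHt _ lt_ijt i j) //; last by lia.
  by rewrite addr0 addrC => /eqP; rewrite addr_eq0 => /eqP ->; rewrite exprS; ring.
suff ht0 : h t 0%N = 0.
  by apply/eqP; have /eqP := h_t u v uvE; rewrite ht0 mulf_eq0 signr_eq0.
have [lt_1|le_1] := ltnP n1 t; first by rewrite h_out ?addn0 ?lt_1.
have [lt_2|le_2] := ltnP n2 t.
  by rewrite -(h_t 0%N t) // h_out ?lt_2 ?orbT ?mulr0.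
have [le_tk12|gt_tk12] := leqP (t + k) (n1 + n2).
  by apply: h_adm; rewrite admissibleE; lia.
have [|a a_top h_k] := @newton_diagonal t (h t 0%N) (k - t) _ h_t; first by lia.
(* The u in [0, k] with k - u > n2 or u > n1; the minimum avoids counting
   a point twice when k > n1 + n2. *)
pose s := iota 0 (minn (k - n2) n1.+1) ++ iota n1.+1 (k - n1).
have /eqP : a (k - t)%N = 0.
  apply: (@binomial_sum_roots _ _ s).
  - rewrite cat_uniq !iota_uniq andbT /=; apply/hasPn => i.
    by rewrite !mem_iota; lia.
  - by rewrite size_cat !size_iota; lia.
  - move=> i; rewrite mem_cat !mem_iota => i_s.
    rewrite -(h_k i (k - i)%N); last by lia.
    by rewrite h_out ?mulr0 //; lia.
by rewrite a_top mulf_eq0 signr_eq0 => /eqP.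
Qed.

End Plane.

(** Dividing by the factorials turns [balanced] into the relation
    with constant coefficients; there the extension by zero outside the box is
    consistent because n - u vanishes at u = n. *)
Lemma balanced_eq0 n1 n2 n3 k (f : nat -> nat -> F) :
    balanced n1 n2 n3 k f ->
    (forall u v, (u + v <= k)%N ->
       [|| n1 < u, n2 < v | n3 < k - (u + v)]%N -> f u v = 0) ->
    (forall m, admissible n1 n2 n3 k m -> f m 0%N = 0) ->
  forall u v, (u + v <= k)%N -> f u v = 0.
Proof.
move=> f_bal f_out f_adm u v le_uvk.
pose D u v : F := (n1 - u)`!%:R * (n2 - v)`!%:R * (n3 - (k - (u + v)))`!%:R.
have D_neq0 i j : D i j != 0 by rewrite !mulf_neq0 ?natr_char0_neq0 ?fact_gt0.
suff: f u v / D u v = 0.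
  by move/eqP; rewrite mulf_eq0 invr_eq0 (negPf (D_neq0 _ _)) orbF => /eqP.
apply: (@plane_eq0 k (fun u v => f u v / D u v) _ n1 n2 n3) => //; first last.
- by move=> m /f_adm ->; rewrite mul0r.
- by move=> i j le_ijk /f_out ->; rewrite ?mul0r.
move=> {u v le_uvk} u v lt_uvk.
have step n i : (i <= n)%N -> forall x : F, (i = n -> x = 0) ->
    x / (n - i.+1)`!%:R = (n - i)%:R * x / (n - i)`!%:R.
  move=> le_in x x0; have [lt_in|le_ni] := ltnP i n; last first.
    by rewrite x0 ?mulr0 ?mul0r //; lia.
  have -> : (n - i = (n - i.+1).+1)%N by lia.
  by rewrite factS natrM [_ * x]mulrC -mulrA invfM mulVKf ?natr_char0_neq0.
have [|in_box] := boolP [|| n1 < u, n2 < v | n3 < k - (u + v).+1]%N.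
  by move=> out; rewrite !f_out ?mul0r ?addr0 //; lia.
have {in_box}[le_u1 [le_v2 le_w3]] : (u <= n1 /\ v <= n2 /\ k - (u + v).+1 <= n3)%N
  by lia.
have kE : (k - (u + v) = (k - (u + v).+1).+1)%N by lia.
rewrite /D addSn addnS kE !invfM.
set w := (k - _)%N in le_w3 kE *.
have E1 := @step n1 u le_u1 (f u.+1 v) ltac:(move=> ?; rewrite f_out //; lia).
have E2 := @step n2 v le_v2 (f u v.+1) ltac:(move=> ?; rewrite f_out //; lia).
have E3 := @step n3 w le_w3 (f u v) ltac:(move=> ?; rewrite f_out //; lia).
have bal := f_bal u v lt_uvk le_u1 le_v2 le_w3; rewrite -/w in bal.
move: E1 E2 E3 bal.
move: (n1 - u)%:R (n2 - v)%:R (n3 - w)%:R (f u.+1 v) (f u v.+1) (f u v).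
move: (n1 - u)`!%:R^-1 (n2 - v)`!%:R^-1 (n3 - w)`!%:R^-1.
move: (n1 - u.+1)`!%:R^-1 (n2 - v.+1)`!%:R^-1 (n3 - w.+1)`!%:R^-1.
move=> A' B' C' A B C a b c x y z E1 E2 E3 bal.
rewrite -[RHS](mul0r (A * B * C)) -bal 2!mulrDl.
congr (_ + _ + _).
- by rewrite !mulrA E1.
- by rewrite [A * B']mulrC !mulrA E2; ring.
- by rewrite [A * B * C']mulrC !mulrA E3; ring.
Qed.

End Uniqueness.

(** * Bases from triangular families of functionals *)

Lemma triangular_is_basis (F : fieldType) (V : lmodType F) (I : finType)
    (r : I -> nat) (phi : I -> {scalar V}) (W : V -> Prop) (b : I -> V) :
    injective r ->
    W 0 -> (forall a p q, W p -> W q -> W (a *: p + q)) ->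
    (forall i, W (b i)) ->
    (forall i j, (r i < r j)%N -> phi i (b j) = 0) ->
    (forall i, phi i (b i) != 0) ->
    (forall p, W p -> (forall i, phi i p = 0) -> p = 0) ->
  is_basis W b.
Proof.
move=> r_inj W0 Wlin Wb phi_lt phi_neq0 phi_sep.
have Wspan c : W (\sum_i c i *: b i).
  by elim/big_rec: _ => // i p _ Wp; apply: Wlin.
split=> [c cb0 i|p].
  move: {2}(r i) (erefl (r i)) => n; elim/ltn_ind: n i => n IHn i riE.
  have := congr1 (phi i) cb0.
  rewrite raddf0 raddf_sum (bigD1 i) //= big1 => [|j ne_ji].
    rewrite addr0 linearZ /= => /eqP.
    by rewrite mulf_eq0 (negPf (phi_neq0 i)) orbF => /eqP.
  rewrite linearZ /=; have [lt_ji|] := ltnP (r j) n.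
    by rewrite (IHn _ lt_ji) ?mul0r.
  rewrite -riE leq_eqVlt => /orP[/eqP/r_inj ij|/phi_lt ->]; last by rewrite mulr0.
  by rewrite ij eqxx in ne_ji.
split=> [Wp|[c ->] //].
(* Gaussian elimination: kill the functionals one rank at a time. *)
suff elim_upto d : exists c : I -> F,
    forall i, (r i < d)%N -> phi i (p - \sum_j c j *: b j) = 0.
  have [c phi0] := elim_upto (\max_i r i).+1.
  exists c; apply/eqP; rewrite -subr_eq0; apply/eqP/phi_sep => [|i]; last first.
    by apply: phi0; rewrite ltnS leq_bigmax.
  by rewrite addrC -scaleN1r; apply: Wlin.
elim: d => [|d [c phi0]]; first by exists (fun=> 0).
have [i0 /eqP ri0|no_d] := pickP (fun i => r i == d); last first.
  by exists c => i; rewrite ltnS leq_eqVlt no_d; apply: phi0.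
set q := p - _ in phi0.
exists (fun i => c i + (i == i0)%:R * (phi i0 q / phi i0 (b i0))) => i.
have -> : \sum_j (c j + (j == i0)%:R * (phi i0 q / phi i0 (b i0))) *: b j
    = \sum_j c j *: b j + (phi i0 q / phi i0 (b i0)) *: b i0.
  under eq_bigr do rewrite scalerDl; rewrite big_split; congr (_ + _).
  rewrite (bigD1 i0) //= eqxx mul1r big1 ?addr0 // => j /negPf ->.
  by rewrite mul0r scale0r.
rewrite opprD addrA -/q linearB linearZ /= ltnS leq_eqVlt => /orP[/eqP rid|lt_id].
  have -> : i = i0 by apply: r_inj; rewrite rid.
  by rewrite divfK ?subrr.
by rewrite (phi0 i lt_id) (phi_lt i i0) ?ri0 // mulr0 subr0.
Qed.

(** * Squarefree polynomials *)

Section Squarefree.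
Variables (F : fieldType) (N : nat).
Implicit Types (E A B : {set 'I_N}) (c : {set 'I_N} -> F).

Lemma prodX_mesym1 E : \prod_(i in E) 'X_i = 'X_[mesym1 E] :> {mpoly F[N]}.
Proof.
rewrite mprodXE; congr 'X_[_]; apply/mnmP => i; rewrite mnmE mnm_sumE.
rewrite big_mkcond (bigD1 i) //= mnmE eqxx big1 ?addn0; first by case: (i \in E).
by move=> j ne_ji; rewrite mnmE (negPf ne_ji) if_same.
Qed.

Definition sqfree k c : {mpoly F[N]} :=
  \sum_(E : {set 'I_N} | #|E| == k) c E *: \prod_(i in E) 'X_i.

Lemma eq_sqfree k c c' :
  (forall E, #|E| = k -> c E = c' E) -> sqfree k c = sqfree k c'.
Proof. by move=> eq_c; apply: eq_bigr => E /eqP/eq_c ->. Qed.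

Lemma mcoeff_sqfree k c E : #|E| = k -> (sqfree k c)@_(mesym1 E) = c E.
Proof.
move=> /eqP cardE; rewrite raddf_sum.
under eq_bigr do rewrite prodX_mesym1 /= mcoeffZ.
rewrite (bigD1 E) //= big1 => [|E' /andP[_ ne_E]].
  by rewrite addr0 mcoeffX eqxx mulr1.
by rewrite mcoeffX (inj_eq (@inj_mesym1 _)) (negPf ne_E) mulr0.
Qed.

Lemma sqfree_eq0 k c : (forall E, #|E| = k -> c E = 0) -> sqfree k c = 0.
Proof. by move=> c0; apply: big1 => E /eqP/c0 ->; rewrite scale0r. Qed.

Lemma sqfree_lin k a c c' :
  a *: sqfree k c + sqfree k c' = sqfree k (fun E => a * c E + c' E).
Proof.
rewrite scaler_sumr -big_split; apply: eq_bigr => E _ /=.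
by rewrite scalerDl scalerA.
Qed.

Lemma mderiv_prodX E i : (\prod_(j in E) 'X_j : {mpoly F[N]})^`M(i)
  = if i \in E then \prod_(j in E :\ i) 'X_j else 0.
Proof.
rewrite !prodX_mesym1 mderivX mnmE; case: ifP => iE; last by rewrite scale0r.
rewrite scale1r; congr 'X_[_]; apply/mnmP => j; rewrite !mnmE !inE eq_sym.
by have [<-|_] := eqVneq i j; rewrite ?iE //= subn0.
Qed.

(** Removing a point from a set of size k.+1 and adding a point to a set of size
    k are the same incidences. *)
Lemma sum_mderiv_sqfree k c : \sum_(i < N) (sqfree k.+1 c)^`M(i)
  = sqfree k (fun E => \sum_(i | i \notin E) c (i |: E)).
Proof.
rewrite /sqfree [RHS](_ : _ = \sum_(E : {set 'I_N} | #|E| == k)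
    \sum_(i | i \notin E) c (i |: E) *: \prod_(j in E) 'X_j); last first.
  by apply: eq_bigr => E _; rewrite scaler_suml.
rewrite [RHS](exchange_big_dep xpredT) //=; apply: eq_bigr => i _.
rewrite raddf_sum /= (bigID (fun E => i \in E)) /=.
rewrite addrC big1 ?add0r => [|E]; last first.
  by case/andP=> _ /negPf iE; rewrite linearZ /= mderiv_prodX iE scaler0.
rewrite (reindex_onto (fun E => i |: E) (fun E => E :\ i)) /=; last first.
  by move=> E /andP[_ iE]; rewrite setD1K.
apply: eq_big => [E|E /andP[/andP[_ _] /eqP EE]].
  rewrite setU11 andbT cardsU1; have [iE|iE] := boolP (i \in E); last first.
    by rewrite setU1K // eqxx !andbT.
  rewrite andbF; apply/negbTE/nandP; right; apply: contraTneq iE => <-.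
  by rewrite !inE eqxx.
by rewrite linearZ /= mderiv_prodX setU11 EE.
Qed.

Lemma in_Vk_sqfree k c : in_Vk k.+1 (sqfree k.+1 c) <->
  forall E, #|E| = k -> \sum_(i | i \notin E) c (i |: E) = 0.
Proof.
rewrite /in_Vk sum_mderiv_sqfree; split=> [[_ D0] E cardE|D0].
  have := mcoeff_sqfree (fun E => \sum_(i | i \notin E) c (i |: E)) cardE.
  by rewrite D0 mcoeff0.
by split; [exists c | apply: sqfree_eq0].
Qed.

Lemma mcoeff_msym_mesym1 (w : 'S_N) (p : {mpoly F[N]}) E :
  (msym w p)@_(mesym1 E) = p@_(mesym1 (w @^-1: E)).
Proof. by rewrite mcoeff_sym; congr (p@__); apply/mnmP => i; rewrite !mnmE inE. Qed.

Lemma msym_sqfree (w : 'S_N) k c :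
    (forall E, #|E| = k -> c (w @^-1: E) = c E) ->
  msym w (sqfree k c) = sqfree k c.
Proof.
move=> c_inv; have imK : cancel (fun E => w^-1%g @^-1: E) (fun E => w @^-1: E).
  by move=> E; apply/setP => i; rewrite !inE permK.
have cardV E : #|w^-1%g @^-1: E| = #|E|.
  by rewrite card_preimset //; apply: perm_inj.
rewrite [RHS](reindex_inj (can_inj imK)) raddf_sum /=.
apply: eq_big => [E|E /eqP cardE]; first by rewrite cardV.
rewrite -(c_inv (w^-1%g @^-1: E)) ?cardV // imK msymZ !prodX_mesym1 msymX.
congr (_ *: 'X_[_]).
by apply/mnmP => i; rewrite !mnmE inE.
Qed.

(** A set inside the union of disjoint A and B is a pair of sets, one in each. *)
Lemma mul_sum_prodX A B (P Q : pred {set 'I_N}) : [disjoint A & B] ->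
  (\sum_(E : {set 'I_N} | (E \subset A) && P E) \prod_(i in E) 'X_i)
  * (\sum_(E : {set 'I_N} | (E \subset B) && Q E) \prod_(i in E) 'X_i)
  = \sum_(E : {set 'I_N} | (E \subset A :|: B) && (P (E :&: A) && Q (E :&: B)))
      \prod_(i in E) 'X_i :> {mpoly F[N]}.
Proof.
move/pred0P=> dAB.
have dAB_in i : (i \in A) && (i \in B) = false by exact: dAB.
rewrite big_distrlr /= pair_big_dep /=.
rewrite (reindex_onto (fun E => (E :&: A, E :&: B)) (fun p => p.1 :|: p.2)) /=.
  apply: eq_big => [E|E /andP[_ /eqP EE]].
    by rewrite !subsetIr -setIUr (sameP eqP setIidPl) andbC.
  rewrite [RHS](big_setID A) /=; congr (_ * _); apply: eq_bigl => i.
  move/setP/(_ i): EE; rewrite !inE; have := dAB_in i.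
  by case: (i \in A); case: (i \in B); case: (i \in E) => // /(_ isT).
case=> [E1 E2] /= /and3P[/andP[/subsetP sE1 _] /subsetP sE2 _].
by congr (_, _); apply/setP => i; rewrite !inE; have := dAB_in i;
   have /implyP := sE1 i; have /implyP := sE2 i;
   case: (i \in A); case: (i \in B); case: (i \in E1); case: (i \in E2).
Qed.

End Squarefree.

(** * Sets and polynomials adapted to the three blocks *)

Section Blocks.
Variables (F : fieldType) (n1 n2 n3 : nat).
Local Notation N := (n1 + n2 + n3)%N.
Local Notation I1 := (intv1 n1 n2 n3).
Local Notation I2 := (intv2 n1 n2 n3).
Local Notation I3 := (intv3 n1 n2 n3).
Implicit Types (E : {set 'I_N}) (f g : nat -> nat -> F).

Lemma card_intvs : [/\ #|I1| = n1, #|I2| = n2 & #|I3| = n3].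
Proof.
have sum_const n (P : pred 'I_n) (b : bool) : P =1 (fun=> b) ->
    (\sum_(i < n) P i = b * n)%N.
  move=> Pb; rewrite (eq_bigr (fun=> b : nat)) => [|i _]; last by rewrite Pb.
  by rewrite sum_nat_const card_ord mulnC.
have cardE (P : pred 'I_N) (b1 b2 b3 : bool) :
    (forall i, P i = if (i < n1)%N then b1
                     else if (i < n1 + n2)%N then b2 else b3) ->
    #|[set i | P i]| = (b1 * n1 + b2 * n2 + b3 * n3)%N.
  move=> PE; rewrite -sum1dep_card big_mkcond !big_split_ord /=.
  rewrite (sum_const _ (fun i => P (lshift n3 (lshift n2 i))) b1); last first.
    by move=> i; rewrite PE /= ltn_ord.
  rewrite (sum_const _ (fun i => P (lshift n3 (rshift n1 i))) b2); last first.
    by move=> i; rewrite PE /= ltn_add2l ltn_ord ltnNge leq_addr.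
  rewrite (sum_const _ (fun i => P (rshift (n1 + n2) i)) b3) // => i.
  by rewrite PE /= -!addnA ltnNge leq_addr /= ltnNge addnA leq_addr.
split.
- rewrite (cardE _ true false false) => [|i]; first lia.
  by have := ltn_ord i; do 2?case: ifP; lia.
- rewrite (cardE _ false true false) => [|i]; first lia.
  by have := ltn_ord i; do 2?case: ifP; lia.
- rewrite (cardE _ false false true) => [|i]; first lia.
  by have := ltn_ord i; do 2?case: ifP; lia.
Qed.

Lemma card_blocks E : #|E| = (#|E :&: I1| + #|E :&: I2| + #|E :&: I3|)%N.
Proof.
rewrite -(cardsID I1 E) -(cardsID I2 (E :\: I1)) addnA.
have -> : (E :\: I1) :&: I2 = E :&: I2 by apply/setP => i; rewrite !inE; lia.
by have -> : (E :\: I1) :\: I2 = E :&: I3 by apply/setP => i; rewrite !inE; lia.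
Qed.

Lemma exists_blocks u v w : (u <= n1)%N -> (v <= n2)%N -> (w <= n3)%N ->
  exists E : {set 'I_N}, [/\ #|E :&: I1| = u, #|E :&: I2| = v & #|E :&: I3| = w].
Proof.
have [c1 c2 c3] := card_intvs.
have draw (A : {set 'I_N}) d : (d <= #|A|)%N ->
    exists2 E : {set 'I_N}, E \subset A & #|E| = d.
  rewrite -bin_gt0 -cards_draws card_gt0 => /set0Pn[E].
  by rewrite inE => /andP[sEA /eqP cE]; exists E.
move=> le_u1 le_v2 le_w3.
have [|A /subsetP sA <-] := draw I1 u; first by rewrite c1.
have [|B /subsetP sB <-] := draw I2 v; first by rewrite c2.
have [|C /subsetP sC <-] := draw I3 w; first by rewrite c3.
exists (A :|: B :|: C); split; apply: eq_card => i;
have := sA i; have := sB i; have := sC i; rewrite !inE;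
by case: (i \in A); case: (i \in B); case: (i \in C) => //=; lia.
Qed.

Lemma mem_Gn (w : 'S_N) : reflect
  (forall i, [/\ (w i \in I1) = (i \in I1), (w i \in I2) = (i \in I2)
                & (w i \in I3) = (i \in I3)])
  (w \in Gn n1 n2 n3).
Proof.
rewrite /Gn /= 2!in_setI -andbA.
apply: (iffP and3P) => [[/astabsP w1 /astabsP w2 /astabsP w3] i|w_st].
  by split; [apply: w1 | apply: w2 | apply: w3].
by split; apply/astabsP => i; case: (w_st i).
Qed.

Lemma card_preim_block (w : 'S_N) E : w \in Gn n1 n2 n3 ->
  #|w @^-1: E :&: I1| = #|E :&: I1| /\ #|w @^-1: E :&: I2| = #|E :&: I2|.
Proof.
move=> /mem_Gn w_st.
split; rewrite -[RHS](card_preimset _ (@perm_inj _ w)); apply: eq_card => i;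
by case: (w_st i) => w1 w2 _; rewrite preimsetI !in_setI; congr (_ && _);
   rewrite [RHS]inE ?w1 ?w2.
Qed.

(** Colour a point by its block and by whether it lies in the set. The two
    colourings have the same numbers of points of each colour, so a
    permutation carries one to the other, and it preserves the blocks because
    the colour records them. *)
Lemma Gn_transitive E E' :
    #|E :&: I1| = #|E' :&: I1| -> #|E :&: I2| = #|E' :&: I2| ->
    #|E :&: I3| = #|E' :&: I3| ->
  exists2 w : 'S_N, w \in Gn n1 n2 n3 & w @^-1: E = E'.
Proof.
move=> e1 e2 e3.
pose col (A : {set 'I_N}) (i : 'I_N) := ((i < n1)%N, (i < n1 + n2)%N, i \in A).
have count_col A x :
    count_mem x [tuple col A i | i < N] = #|[set i | col A i == x]|.
  by rewrite count_map -sum1_count big_enum_cond sum1dep_card.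
have cardD A B (I : {set 'I_N}) :
    #|A :&: I| = #|B :&: I| -> #|I :\: A| = #|I :\: B|.
  by move=> eAB; rewrite !cardsD ![I :&: _]setIC eAB.
have d1 := cardD _ _ _ e1; have d2 := cardD _ _ _ e2; have d3 := cardD _ _ _ e3.
have colE A b1 b2 b3 : [set i | col A i == (b1, b2, b3)] =
    (if b3 then A else ~: A) :&: (if b1 then (if b2 then I1 else set0)
                                  else if b2 then I2 else I3).
  apply/setP => i; rewrite !inE !xpair_eqE.
  case: b1; case: b2; case: b3; rewrite !inE; case: (i \in A) => /=; lia.
have : perm_eq [tuple col E' i | i < N] [tuple col E i | i < N].
  apply/allP => -[[b1 b2] b3] _ /=; rewrite !count_col !colE.
  case: b3; first by case: b1; case: b2; rewrite ?e1 ?e2 ?e3 ?setI0.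
  rewrite ![~: _ :&: _]setIC -!setDE.
  by case: b1; case: b2; rewrite ?d1 ?d2 ?d3 ?set0D.
move=> /tuple_permP[w wE].
have colw i : col E' i = col E (w i).
  have := congr1 (fun s => nth (col E' i) s i) wE.
  by rewrite -!tnth_nth !tnth_mktuple.
exists w; first by apply/mem_Gn => i; case: (colw i); rewrite !inE; split; lia.
by apply/setP => i; rewrite inE; case: (colw i).
Qed.

(** Up to the choice of the table f, every squarefree form of degree k invariant
    under the block group is of this shape. *)
Definition blockpoly k f : {mpoly F[N]} :=
  sqfree k (fun E => f #|E :&: I1| #|E :&: I2|).

Lemma esym_blocks u v w :
  esym_on F I1 u * esym_on F I2 v * esym_on F I3 w
  = \sum_(E | [&& #|E :&: I1| == u, #|E :&: I2| == v & #|E :&: I3| == w])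
      \prod_(i in E) 'X_i.
Proof.
rewrite mul_sum_prodX; last by apply/pred0P => i; rewrite !inE; lia.
rewrite mul_sum_prodX; last by apply/pred0P => i; rewrite !inE; lia.
apply: eq_bigl => E.
have -> : E \subset I1 :|: I2 :|: I3.
  by apply/subsetP => i _; rewrite !inE; lia.
have -> : E :&: (I1 :|: I2) :&: I1 = E :&: I1 by apply/setP => i; rewrite !inE; lia.
have -> : E :&: (I1 :|: I2) :&: I2 = E :&: I2 by apply/setP => i; rewrite !inE; lia.
by rewrite /= andbA.
Qed.

Lemma psi_blockpoly k m :
  psi F n1 n2 n3 k m = blockpoly k (fun u v => psit n1 n2 n3 k m u%:R v%:R).
Proof.
rewrite /blockpoly /sqfree; have lt_k E i : #|E| == k -> (#|E :&: i| < k.+1)%N.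
  by move=> /eqP <-; rewrite ltnS subset_leq_card // subsetIl.
rewrite (partition_big (fun E => inord #|E :&: I1| : 'I_k.+1) xpredT) //.
apply: eq_bigr => u _.
rewrite (partition_big (fun E => inord #|E :&: I2| : 'I_k.+1)
  (fun v : 'I_k.+1 => u + v <= k)%N).
  apply: eq_bigr => v le_uvk; rewrite esym_blocks scaler_sumr.
  apply: eq_big => [E|E /and3P[/eqP-> /eqP-> _] //].
  apply/and3P/idP => [[/eqP Eu /eqP Ev /eqP Ew]|].
    have cE : #|E| == k by rewrite card_blocks Eu Ev Ew; apply/eqP; lia.
    by rewrite cE Eu Ev !inord_val !eqxx.
  case/andP=> /andP[cE /eqP <-] /eqP <-; rewrite !inordK ?lt_k //; split=> //.
  by move/eqP: cE; rewrite card_blocks => <-; apply/eqP; lia.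
move=> E /andP[cE /eqP <-]; rewrite !inordK ?lt_k //.
by move/eqP: cE; rewrite card_blocks => <-; lia.
Qed.

End Blocks.

(** * Invariants of the block group annihilated by the lowering operator *)

Section Invariants.
Variables (F : fieldType) (n1 n2 n3 : nat).
Local Notation N := (n1 + n2 + n3)%N.
Local Notation I1 := (intv1 n1 n2 n3).
Local Notation I2 := (intv2 n1 n2 n3).
Local Notation I3 := (intv3 n1 n2 n3).
Implicit Types (E : {set 'I_N}) (f : nat -> nat -> F).

(** A point outside E increases exactly one of the three counts, and block j has
    n_j minus #|E :&: I_j| such points. *)
Lemma sum_add_point f E :
  \sum_(i | i \notin E) f #|(i |: E) :&: I1| #|(i |: E) :&: I2|
  = (n1 - #|E :&: I1|)%:R * f #|E :&: I1|.+1 #|E :&: I2|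
    + (n2 - #|E :&: I2|)%:R * f #|E :&: I1| #|E :&: I2|.+1
    + (n3 - #|E :&: I3|)%:R * f #|E :&: I1| #|E :&: I2|.
Proof.
have [c1 c2 c3] := card_intvs n1 n2 n3.
have cardU1 i (I : {set 'I_N}) : i \notin E ->
    #|(i |: E) :&: I| = ((i \in I) + #|E :&: I|)%N.
  move=> iE; rewrite setIUl; have [iI|iI] := boolP (i \in I).
    have -> : [set i] :&: I = [set i] by apply/setIidPl; rewrite sub1set.
    by rewrite cardsU1 inE (negPf iE).
  have -> : [set i] :&: I = set0; last by rewrite set0U.
  by apply/setP => j; rewrite !inE; case: eqP => // ->; apply/negbTE.
have sum_block (I : {set 'I_N}) (x : F) (G : 'I_N -> F) :
    (forall i, i \in I -> i \notin E -> G i = x) ->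
    \sum_(i in I :\: E) G i = (#|I| - #|E :&: I|)%:R * x.
  move=> Gx; rewrite (eq_bigr (fun=> x)) => [|i]; last first.
    by rewrite inE => /andP[iE iI]; apply: Gx.
  by rewrite sumr_const cardsD [I :&: E]setIC mulr_natl.
pose G i := f #|(i |: E) :&: I1| #|(i |: E) :&: I2|.
rewrite (bigID (mem I1)) [X in _ + X = _](bigID (mem I2)) /= addrA.
congr (_ + _ + _).
- rewrite -[X in (X - _)%N]c1 -(sum_block I1 _ G).
    by apply: eq_bigl => i; rewrite !inE.
  move=> i iI iE; rewrite /G !cardU1 // iI.
  by have -> : (i \in I2) = false by move: iI; rewrite !inE; lia.
- rewrite -[X in (X - _)%N]c2 -(sum_block I2 _ G).
    by apply: eq_bigl => i; rewrite !inE; case: (i \in E); lia.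
  move=> i iI iE; rewrite /G !cardU1 // iI.
  by have -> : (i \in I1) = false by move: iI; rewrite !inE; lia.
- rewrite -[X in (X - _)%N]c3 -(sum_block I3 _ G).
    by apply: eq_bigl => i; rewrite !inE; case: (i \in E); lia.
  move=> i iI iE; rewrite /G !cardU1 //.
  have -> : (i \in I1) = false by move: iI; rewrite !inE; lia.
  by have -> : (i \in I2) = false by move: iI; rewrite !inE; lia.
Qed.

Lemma card_block_le E :
  [/\ #|E :&: I1| <= n1, #|E :&: I2| <= n2 & #|E :&: I3| <= n3]%N.
Proof.
have [c1 c2 c3] := card_intvs n1 n2 n3.
by split; [rewrite -[X in (_ <= X)%N]c1 | rewrite -[X in (_ <= X)%N]c2
          | rewrite -[X in (_ <= X)%N]c3]; apply/subset_leq_card/subsetIr.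
Qed.

Lemma in_Vk_blockpoly k f :
  in_Vk k.+1 (blockpoly n1 n2 n3 k.+1 f) <-> balanced n1 n2 n3 k.+1 f.
Proof.
rewrite in_Vk_sqfree; split=> [D0 u v lt_uvk le_u1 le_v2|bal E cardE].
  rewrite subSS => le_w3; have [E [Eu Ev Ew]] := exists_blocks le_u1 le_v2 le_w3.
  have := D0 E; rewrite sum_add_point Eu Ev Ew; apply.
  by rewrite card_blocks Eu Ev Ew; lia.
have [le1 le2 le3] := card_block_le E.
have := card_blocks E; rewrite cardE => kE.
have wE : (k - (#|E :&: I1| + #|E :&: I2|) = #|E :&: I3|)%N by lia.
rewrite sum_add_point; have := bal #|E :&: I1| #|E :&: I2|.
by rewrite subSS wE; apply=> //; lia.
Qed.

Lemma blockpoly_invariant k f :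
  perm_invariant (Gn n1 n2 n3) (blockpoly n1 n2 n3 k f).
Proof.
move=> w wG; apply: msym_sqfree => E _.
by have [-> ->] := card_preim_block E wG.
Qed.

(** The table records the coefficient of any set of the given type, and 0 when
    there is none, i.e. outside the box. *)
Lemma invariant_blockpoly k (p : {mpoly F[N]}) :
    in_Vk k p -> perm_invariant (Gn n1 n2 n3) p ->
  exists2 f, p = blockpoly n1 n2 n3 k f &
    forall u v, (u + v <= k)%N ->
      [|| n1 < u, n2 < v | n3 < k - (u + v)]%N -> f u v = 0.
Proof.
move=> [[c pE] _] p_inv; have {}pE : p = sqfree k c by [].
pose of_type u v E := [&& #|E| == k, #|E :&: I1| == u & #|E :&: I2| == v].
exists (fun u v => if [pick E | of_type u v E] is Some E then c E else 0).
  rewrite pE; apply: eq_sqfree => E' cardE'.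
  case: pickP => [E /and3P[/eqP cardE /eqP Eu /eqP Ev]|/(_ E')]; last first.
    by rewrite /of_type cardE' !eqxx.
  have [|||w wG <-] := @Gn_transitive n1 n2 n3 E E'; rewrite ?Eu ?Ev //.
    by have := card_blocks E; have := card_blocks E'; lia.
  have cardwE : #|w @^-1: E| = k by rewrite card_preimset //; apply: perm_inj.
  rewrite -(mcoeff_sqfree c cardwE) -(mcoeff_sqfree c cardE) -pE.
  by rewrite -mcoeff_msym_mesym1 p_inv.
move=> u v le_uvk out; case: pickP => // E /and3P[/eqP cardE /eqP Eu /eqP Ev].
have [le1 le2 le3] := card_block_le E; have := card_blocks E.
by lia.
Qed.

Lemma mcoeff_blockpoly k f u v E :
    #|E| = k -> #|E :&: I1| = u -> #|E :&: I2| = v ->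
  (blockpoly n1 n2 n3 k f)@_(mesym1 E) = f u v.
Proof. by move=> cE <- <-; rewrite mcoeff_sqfree. Qed.

End Invariants.

Theorem proposition5 (F : fieldType) (charF0 : [pchar F] =i pred0)
    (n1 n2 n3 k : nat) (hn1 : (1 <= n1)%N) (hn2 : (1 <= n2)%N)
    (hn3 : (1 <= n3)%N) (hk1 : (1 <= k)%N) (hk : (2 * k <= n1 + n2 + n3)%N) :
  is_basis
    (fun p : {mpoly F[n1 + n2 + n3]} =>
       in_Vk k p /\ perm_invariant (Gn n1 n2 n3) p)
    (fun m : psi_index n1 n2 n3 k => psi F n1 n2 n3 k (val (val m))).
Proof.
case: k hk1 hk => [//|k] _ _.
(* The functional of index m reads the entry (m, 0) of the table off the
   coefficient of a set with m, 0 and k.+1 - m points in the blocks. *)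
pose is_marker (m : nat) (E : {set 'I_(n1 + n2 + n3)}) :=
  [&& #|E| == k.+1, #|E :&: intv1 n1 n2 n3| == m
    & #|E :&: intv2 n1 n2 n3| == 0%N].
pose marker m := odflt set0 [pick E | is_marker m E].
have mcoeff_marker m f : admissible n1 n2 n3 k.+1 m ->
    (blockpoly n1 n2 n3 k.+1 f)@_(mesym1 (marker m)) = f m 0%N :> F.
  rewrite admissibleE => /and5P[le_k3 le_m1 le_m2 le_mk _].
  have [|E [Eu Ev Ew]] := @exists_blocks n1 n2 n3 m 0 (k.+1 - m) le_m1 isT.
    by lia.
  rewrite /marker; case: pickP => [E' /and3P[/eqP cE /eqP Em /eqP E0]|/(_ E)] /=.
    exact: mcoeff_blockpoly.
  by rewrite /is_marker card_blocks Eu Ev Ew !eqxx !andbT; lia.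
apply: (@triangular_is_basis _ _ _ (fun i => val (val i))
  (fun i => mcoeff (mesym1 (marker (val (val i)))) : {scalar _})).
- by move=> i j /val_inj /val_inj.
- have -> : 0 = blockpoly n1 n2 n3 k.+1 (fun _ _ => 0 : F).
    by rewrite [RHS]sqfree_eq0.
  by split; [apply/in_Vk_blockpoly => u v *; rewrite !mulr0 !addr0
            | apply: blockpoly_invariant].
- move=> a p q [Vp Gp] [Vq Gq].
  have [f pE _] := invariant_blockpoly Vp Gp.
  have [g qE _] := invariant_blockpoly Vq Gq.
  rewrite {}pE {}qE in Vp Vq *; rewrite [_ + _]sqfree_lin.
  pose fg u v := a * f u v + g u v.
  split; last exact: (@blockpoly_invariant F n1 n2 n3 k.+1 fg).
  apply/(@in_Vk_blockpoly F n1 n2 n3 k fg).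
  by move: Vp Vq => /in_Vk_blockpoly balf /in_Vk_blockpoly; apply: balanced_lin.
- move=> i; rewrite psi_blockpoly; split; last exact: blockpoly_invariant.
  by apply/in_Vk_blockpoly/psit_balanced.
- move=> i j lt_ij /=; rewrite psi_blockpoly mcoeff_marker ?(valP i) //.
  by rewrite /psit psit2_eq0 ?mulr0 // addn0.
- move=> i /=; rewrite psi_blockpoly mcoeff_marker ?(valP i) //.
  have := valP i; rewrite admissibleE => /and5P[_ le_m1 le_m2 le_mk le_mk12].
  by rewrite /psit addr0 mulf_neq0 ?psit1_neq0 ?psit2_neq0.
- move=> p [Vp Gp] phi0; have [f pE f_out] := invariant_blockpoly Vp Gp.
  rewrite {}pE in Vp phi0 *; apply: sqfree_eq0 => E cardE.
  apply: (balanced_eq0 charF0 (k := k.+1) _ f_out) => [|m adm_m|].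
  + exact/in_Vk_blockpoly.
  + have lt_mk : (m < k.+2)%N by move: adm_m; rewrite admissibleE; lia.
    by rewrite -(mcoeff_marker m f adm_m) -(phi0 (exist _ (Ordinal lt_mk) adm_m)).
  + by have := card_blocks E; rewrite cardE; lia.
Qed.
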